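(* Let $(X,\psi)$ be a weighted space and let $(P_t)_{t\ge 0}$ be a family of bounded linear operators $P_t\colon\mathcal{B}^{\psi}(X)\to\mathcal{B}^{\psi}(X)$ such that: (1) $P_0=I$, the identity on $\mathcal{B}^{\psi}(X)$; (2) $P_{t+s}=P_tP_s$ for all $t,s\ge 0$; (3) for all $f\in\mathcal{B}^{\psi}(X)$ and $x\in X$, $\lim_{t\to 0+}P_tf(x)=f(x)$; (4) there exist $C\in\mathbb{R}$ and $\varepsilon>0$ such that $\lVert P_t\rVert_{L(\mathcal{B}^{\psi}(X))}\le C$ for all $t\in[0,\varepsilon]$. Then $(P_t)_{t\ge 0}$ is strongly continuous on $\mathcal{B}^{\psi}(X)$, that is, $\lim_{t\to 0+}\lVert P_tf-f\rVert_{\psi}=0$ for all $f\in\mathcal{B}^{\psi}(X)$.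
   Context: Let $X$ be a completely regular Hausdorff topological space. A function $\psi\colon X\to(0,\infty)$ is an admissible weight function if $K_R:=\{x\in X:\psi(x)\le R\}$ is compact for every $R>0$; then $(X,\psi)$ is called a weighted space. Let $\mathrm{B}^{\psi}(X)$ be the Banach space of all functions $f\colon X\to\mathbb{R}$ with $\lVert f\rVert_{\psi}:=\sup_{x\in X}\psi(x)^{-1}|f(x)|<\infty$, with norm $\lVert\cdot\rVert_{\psi}$. $\mathcal{B}^{\psi}(X)$ denotes the closure in $\mathrm{B}^{\psi}(X)$ of the space $\mathrm{C}_b(X)$ of bounded continuous functions $X\to\mathbb{R}$. $L(E)$ denotes the bounded linear operators on a Banach space $E$ with the operator norm. *)

(* Defs.v *)
From HB Require Import structures.
From mathcomp Require Import all_boot all_order all_algebra.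
From mathcomp Require Import all_classical all_reals all_analysis.

Set Implicit Arguments.
Unset Strict Implicit.
Unset Printing Implicit Defensive.

Import Order.TTheory GRing.Theory Num.Theory.
Import numFieldNormedType.Exports.

Local Open Scope classical_set_scope.
Local Open Scope ring_scope.

Record weight (R : realType) (X : topologicalType) := Weight {
  weight_fun :> X -> R;
  weight_gt0 : forall x, 0 < weight_fun x;
  weight_compact : forall r : R, 0 < r -> compact [set x | weight_fun x <= r]
}.

Section WeightedBounded.
Context (R : realType) (X : topologicalType) (psi : weight R X).

Definition weighted_range (f : X -> R) : set R :=
  range (fun x => (psi x)^-1 * `|f x|).

Definition weighted_bounded : {pred X -> R} :=
  fun f => `[< has_ubound (weighted_range f) >].

Lemma weighted_boundedP (f : X -> R) :
  reflect (exists M, forall x, `|f x| <= M * psi x) (f \in weighted_bounded).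
Proof.
apply: (iffP (asboolP _)) => -[M fM]; exists M.
  move=> x; rewrite -ler_pdivrMr ?weight_gt0// mulrC.
  by apply: fM; exists x.
by move=> _ [x _ <-]; rewrite mulrC ler_pdivrMr ?weight_gt0.
Qed.

Lemma weighted_bounded_submod : submod_closed weighted_bounded.
Proof.
split.
  apply/weighted_boundedP; exists 0 => x.
  by rewrite [X in `|X|](_ : _ = 0)// normr0 mul0r.
move=> a f g /weighted_boundedP[M fM] /weighted_boundedP[N gN].
apply/weighted_boundedP; exists (`|a| * M + N) => x.
rewrite [X in `|X|](_ : _ = a * f x + g x)//.
rewrite (le_trans (ler_normD _ _))// mulrDl lerD// normrM -mulrA.
by rewrite ler_wpM2l.
Qed.

HB.instance Definition _ :=
  GRing.isSubmodClosed.Build R (X -> R) weighted_bounded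
    weighted_bounded_submod.

(** [wbfun] is B^psi(X), a Banach space for [wnorm]. *)
Record wbfun := WBFun {
  wbfun_fun :> X -> R;
  wbfunP : wbfun_fun \in weighted_bounded
}.

HB.instance Definition _ := [isSub for wbfun_fun].
HB.instance Definition _ := [Choice of wbfun by <:].
HB.instance Definition _ := [SubChoice_isSubLmodule of wbfun by <:].

(** [sup set0 = 0], so this is also the right value when [X] is empty. *)
Definition wnorm (f : wbfun) : R := sup (weighted_range f).

Lemma ler_wnorm (f : wbfun) (x : X) : `|f x| <= wnorm f * psi x.
Proof.
rewrite -ler_pdivrMr ?weight_gt0// mulrC.
by apply: ub_le_sup; [exact/asboolP/(wbfunP f)|exists x].
Qed.

Lemma wnorm_ge0 (f : wbfun) : 0 <= wnorm f.
Proof.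
have [[x _]|X0] := pselect (exists x : X, True); last first.
  rewrite /wnorm (_ : weighted_range f = set0) ?sup0//.
  by rewrite -subset0 => y [x _ _]; apply: X0; exists x.
by rewrite -(pmulr_lge0 _ (weight_gt0 psi x)) (le_trans _ (ler_wnorm f x)).
Qed.

Lemma wnorm_le (f : wbfun) (M : R) :
  0 <= M -> (forall x, `|f x| <= M * psi x) -> wnorm f <= M.
Proof.
move=> M0 fM.
have [f0|f0] := pselect (weighted_range f = set0).
  by rewrite /wnorm f0 sup0.
move/eqP/set0P in f0; apply: ge_sup => // _ [x _ <-].
by rewrite mulrC ler_pdivrMr ?weight_gt0.
Qed.

Lemma ler_wnormD (f g : wbfun) : wnorm (f + g) <= wnorm f + wnorm g.
Proof.
apply: wnorm_le => [|x]; first by rewrite addr_ge0 ?wnorm_ge0.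
rewrite [X in `|X|](_ : _ = f x + g x)//.
by rewrite (le_trans (ler_normD _ _))// mulrDl lerD ?ler_wnorm.
Qed.

Lemma wnormZ (a : R) (f : wbfun) : wnorm (a *: f) = `|a| * wnorm f.
Proof.
have leZ (b : R) (g : wbfun) : wnorm (b *: g) <= `|b| * wnorm g.
  apply: wnorm_le => [|x]; first by rewrite mulr_ge0 ?wnorm_ge0.
  rewrite [X in `|X|](_ : _ = b * g x)// normrM -mulrA.
  by rewrite ler_wpM2l ?ler_wnorm.
apply/eqP; rewrite eq_le leZ/=.
have [->|a0] := eqVneq a 0; first by rewrite normr0 mul0r wnorm_ge0.
have := leZ a^-1 (a *: f).
by rewrite scalerA mulVf// scale1r normfV -ler_pdivrMl ?invr_gt0 ?normr_gt0// invrK.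
Qed.

Lemma wnorm0_eq0 (f : wbfun) : wnorm f = 0 -> f = 0.
Proof.
move=> f0; apply/val_inj/funext => x; apply/eqP.
by rewrite -normr_le0 (le_trans (ler_wnorm f x))// f0 mul0r.
Qed.

HB.instance Definition _ :=
  Lmodule_isNormed.Build R wbfun ler_wnormD wnormZ wnorm0_eq0.

Lemma wbfun_complete (F : set_system wbfun) :
  ProperFilter F -> cauchy F -> cvg F.
Proof.
move=> FF /cauchyP Fc.
have nearF (e : R) : 0 < e -> exists f : wbfun,
    F [set g : wbfun | forall x, `|f x - g x| <= e * psi x].
  move=> e0; have [f Ff] := Fc _ e0; exists f.
  apply: filterS Ff => g; rewrite -ball_normE/= => fg x.
  apply: (le_trans (ler_wnorm (f - g) x)).
  by rewrite ler_wpM2r ?(ltW (weight_gt0 _ _)) ?(ltW fg).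
pose ev (x : X) (f : wbfun) : R^o := f x.
have Fev x : cvg (ev x f @[f --> F]).
  apply: cauchy_cvg; apply/cauchyP => e e0.
  have [f Ff] := nearF (e / 2 / psi x)
    ltac:(by rewrite !divr_gt0 ?weight_gt0).
  exists (f x); change (F [set g : wbfun | ball (f x : R^o) e (g x)]).
  apply: filterS Ff => g /(_ x) fg.
  rewrite -ball_normE/=; apply: (le_lt_trans fg).
  by rewrite divfK ?gt_eqF ?weight_gt0// ltr_pdivrMr// ltr_pMr// ltr1n.
pose h (x : X) : R := lim (ev x f @[f --> F]).
have hle (f : wbfun) (e : R) :
    F [set g : wbfun | forall x, `|f x - g x| <= e * psi x] ->
    forall x, `|f x - h x| <= e * psi x.
  move=> Ff x.
  have fgh : `|f x - ev x g| @[g --> F] --> `|f x - h x|.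
    by apply: cvg_norm; apply: cvgB; [exact: cvg_cst|exact: Fev].
  apply: (@closed_cvg _ _ F _ _ [set y | y <= e * psi x] _ _ _ fgh).
    exact: closed_le.
  by apply: filterS Ff => g /(_ x).
have hb : h \in weighted_bounded.
  have [f /hle fh] := nearF _ ltr01; apply/weighted_boundedP.
  exists (1 + wnorm f) => x; rewrite mulrDl.
  rewrite -[h x](subrK (f x)) (le_trans (ler_normD _ _))//.
  by rewrite lerD ?ler_wnorm// distrC.
apply/cvg_ex; exists (WBFun hb); apply/cvgrPdist_le => e e0.
have e20 : 0 < e / 2 by rewrite divr_gt0.
have [f Ff] := nearF _ e20.
apply: filterS (Ff) => g fg.
apply: wnorm_le (ltW e0) _ => x.
rewrite [X in `|X|](_ : _ = h x - g x)// -(subrK (f x) (h x)) -addrA.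
rewrite (le_trans (ler_normD _ _))// [X in X * _]splitr mulrDl lerD//.
by rewrite distrC hle.
Qed.

HB.instance Definition _ := Uniform_isComplete.Build wbfun wbfun_complete.

Definition Cb : set wbfun :=
  [set f | continuous (f : X -> R) /\ bounded_fun (f : X -> R)].

Lemma bounded_fun_exP (f : X -> R) :
  bounded_fun f <-> exists M, forall x, `|f x| <= M.
Proof.
split=> [fb|[M fM]].
  have [M fM] := @filter_ex _ (+oo_R) _ _ fb.
  by exists M => x; exact: fM.
rewrite /= /bounded_near; near=> N => x _ /=.
by rewrite (le_trans (fM x))//; near: N; exact: nbhs_pinfty_ge.
Unshelve. all: by end_near. Qed.

(** On a Hausdorff space psi is bounded away from 0, so that every bounded
    function has finite psi-norm: [Cb] is all of C_b(X). *)
Lemma bounded_fun_weighted_bounded (g : X -> R) : hausdorff_space X ->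
  bounded_fun g -> g \in weighted_bounded.
Proof.
move=> hX gb.
have /bounded_fun_exP[M gM] := gb.
suff [d d0 dpsi] : exists2 d : R, 0 < d & forall x, d <= psi x.
  apply/weighted_boundedP; exists (`|M| / d) => x.
  rewrite (le_trans (gM x))// (le_trans (ler_norm M))//.
  by rewrite mulrAC ler_pdivlMr// ler_wpM2l.
apply: contrapT => nd.
pose K (e : R) : set X := [set x | psi x <= e].
have K0 (e : R) : 0 < e -> K e !=set0.
  move=> e0; apply: contrapT => Ke; apply: nd; exists e => // x.
  by rewrite leNgt; apply/negP => /ltW xe; apply: Ke; exists x.
pose F : set_system X := filter_from [set e : R | 0 < e] K.
have FF : ProperFilter F.
  apply: filter_from_proper => //; apply: filter_from_filter; first by exists 1 => //=.
  move=> a b /= a0 b0; exists (Num.min a b); first by rewrite /= lt_min a0 b0.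
  by move=> x; rewrite /K/= le_min => /andP[].
have FK1 : F (K 1) by exists 1 => //=.
have [p [_ clp]] := @weight_compact _ _ psi 1 ltr01 F FF FK1.
have pe (e : R) : 0 < e -> psi p <= e.
  move=> e0; have /closure_id Ke : closed (K e).
    by apply: compact_closed => //; exact: weight_compact.
  by change (K e p); rewrite Ke =>  B; apply: clp; exists e.
have p2 : 0 < psi p / 2 by rewrite divr_gt0 ?weight_gt0.
have := pe _ p2.
by rewrite leNgt ltr_pdivrMr// ltr_pMr ?weight_gt0// ltr1n.
Qed.

Definition closure_Cb : {pred wbfun} := fun f => `[< closure Cb f >].

Lemma closure_CbP (f : wbfun) : f \in closure_Cb <->
  forall e : R, 0 < e -> exists2 g, Cb g & `|f - g| < e.
Proof.
split=> [/asboolP fC e e0|fC].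
  by have [g [gC fg]] := fC _ (nbhsx_ballx f e e0); exists g.
apply/asboolP => B /nbhs_ballP[e /= e0 eB]; have [g gC fg] := fC _ e0.
by exists g; split => //; exact: eB.
Qed.

Lemma Cb_linear (a : R) (f g : wbfun) : Cb f -> Cb g -> Cb (a *: f + g).
Proof.
move=> [fc /bounded_fun_exP[M fM]] [gc /bounded_fun_exP[N gN]]; split.
  move=> x; apply: cvgD; last exact: gc.
  by apply: cvgZr; exact: fc.
apply/bounded_fun_exP; exists (`|a| * M + N) => x.
rewrite [X in `|X|](_ : _ = a * f x + g x)//.
by rewrite (le_trans (ler_normD _ _))// lerD ?gN// normrM ler_wpM2l.
Qed.

Lemma closure_Cb_submod : submod_closed closure_Cb.
Proof.
split.
  apply/closure_CbP => e e0; exists 0; last by rewrite subr0 normr0.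
  split; first by move=> x; exact: cvg_cst.
  apply/bounded_fun_exP; exists 0 => x.
  by rewrite [X in `|X|](_ : _ = 0)// normr0.
move=> a f g /closure_CbP fC /closure_CbP gC; apply/closure_CbP => e e0.
have a1 : 0 < `|a| + 1 by rewrite ltr_wpDl.
have [f' f'C ff'] := fC (e / 2 / (`|a| + 1)) ltac:(by rewrite !divr_gt0).
have [g' g'C gg'] := gC (e / 2) ltac:(by rewrite divr_gt0).
exists (a *: f' + g'); first exact: Cb_linear.
rewrite opprD addrACA -scalerBr (le_lt_trans (ler_normD _ _))//.
rewrite [ltRHS]splitr ler_ltD// normrZ.
rewrite (@le_trans _ _ ((`|a| + 1) * `|f - f'|))// ?ler_wpM2r ?lerDl//.
by rewrite mulrC -ler_pdivlMr// ltW.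
Qed.

HB.instance Definition _ :=
  GRing.isSubmodClosed.Build R wbfun closure_Cb closure_Cb_submod.

(** [wcfun] is the closure of C_b(X) in B^psi(X), with the induced norm. *)
Record wcfun := WCFun {
  wcfun_wb :> wbfun;
  wcfunP : wcfun_wb \in closure_Cb
}.

HB.instance Definition _ := [isSub for wcfun_wb].
HB.instance Definition _ := [Choice of wcfun by <:].
HB.instance Definition _ := [SubChoice_isSubLmodule of wcfun by <:].

Definition wcnorm (f : wcfun) : R := `|f : wbfun|.

Lemma ler_wcnormD (f g : wcfun) : wcnorm (f + g) <= wcnorm f + wcnorm g.
Proof. exact: ler_normD. Qed.

Lemma wcnormZ (a : R) (f : wcfun) : wcnorm (a *: f) = `|a| * wcnorm f.
Proof. exact: (normrZ a (f : wbfun)). Qed.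

Lemma wcnorm0_eq0 (f : wcfun) : wcnorm f = 0 -> f = 0.
Proof. by move=> /normr0_eq0 f0; exact: val_inj. Qed.

HB.instance Definition _ :=
  Lmodule_isNormed.Build R wcfun ler_wcnormD wcnormZ wcnorm0_eq0.

Lemma wcfun_complete (F : set_system wcfun) :
  ProperFilter F -> cauchy F -> cvg F.
Proof.
move=> FF /cauchyP Fc.
have : cvg (wcfun_wb @ F).
  apply: cauchy_cvg; apply/cauchyP => e e0; have [f Ff] := Fc _ e0.
  by exists (f : wbfun).
move=> /cvg_ex[h Fh].
have hC : h \in closure_Cb.
  apply/asboolP; apply: (@closed_cvg _ _ F FF wcfun_wb _ _ _ h Fh).
    exact: closed_closure.
  by apply: filterE => f; exact/asboolP/(wcfunP f).
apply/cvg_ex; exists (WCFun hC); apply/cvgrPdist_lt => e e0.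
by move/cvgrPdist_lt : Fh => /(_ _ e0); apply: filterS.
Qed.

HB.instance Definition _ := Uniform_isComplete.Build wcfun wcfun_complete.

End WeightedBounded.

Section Operators.
Context (R : realType) (E F : normedModType R).

Definition bounded_linear (T : E -> F) : Prop := linear T /\ bounded_fun_norm T.

(** Only meaningful when [T] is bounded: the real [sup] of a set without upper
    bound is 0. *)
Definition opnorm (T : E -> F) : R :=
  sup [set `|T f| | f in [set f : E | `|f| <= 1]].

End Operators.

(* Main.v *)
Require Import Defs.
From mathcomp Require Import all_boot all_order all_algebra.
From mathcomp Require Import all_classical all_reals all_analysis.
From mathcomp Require Import ring lra.

Set Implicit Arguments.
Unset Strict Implicit.
Unset Printing Implicit Defensive.

Import Order.TTheory GRing.Theory Num.Theory.
Import numFieldNormedType.Exports.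

Local Open Scope classical_set_scope.
Local Open Scope ring_scope.

(** A weakly right-continuous, locally bounded semigroup is strongly continuous;
    here weak continuity is replaced throughout by its pointwise shadow, so that
    no dual space, measure or integral of the orbit is needed.

    The link between pointwise and norm convergence is Mazur's phenomenon: if a
    bounded sequence in the closure of C_b(X) converges pointwise to an f of the
    same space, then combinations of its terms approach f in norm
    ([closure_pointwise_limit]). It is usually derived from Riesz
    representation and dominated convergence. The route here is Simons'
    inequality ([simons_small_element]), an elementary convexity argument which
    only asks that every nonzero element attain its norm at one of the
    functionals f |-> f x / psi x. It does: psi is lower semicontinuous, f is
    continuous on the compact sublevel sets of psi, and |f| / psi is small off
    a large sublevel set ([wcfun_norm_attained]).

    Fix f and write u t = P_t f. By the Mazur property every u p is a norm
    limit of rational combinations of the u q with q rational, since u q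
    converges pointwise to u p as q decreases to p. So countably many
    balls of radius e cover the orbit, and each pulls back under u to a set of
    times that is closed under limits from the right. A Baire argument for such
    sets ([right_closed_cover]) yields, inside any interval, a subinterval ]a, b[
    on which u oscillates by at most 2 e ([small_oscillation]). If b <= t, applying
    P_(t - m), with m in ]a, b[, transports this to the right of t:
    P_h (u t) - u t = P_(t - m) (u (m + h) - u m) is small. Hence u t is a vector of
    strong continuity for every small t > 0. These vectors form a linear
    subspace, closed by local boundedness, and f is the pointwise limit of u t as t
    decreases to 0, so a second use of the Mazur property puts f in it. *)

(** * Simons' inequality *)

Lemma ler_dist_halving (R : realType) (V : normedZmodType R) (c : nat -> V)
    (M : R) (n : nat) :
  (forall k, (n <= k)%N -> `|c k.+1 - c k| <= M / 2 ^+ k.+1) ->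
  forall m, (n <= m)%N -> `|c m - c n| <= M / 2 ^+ n.
Proof.
move=> cM m nm.
have M0 : 0 <= M.
  have := le_trans (normr_ge0 _) (cM n (leqnn n)).
  by rewrite pmulr_lge0 ?invr_gt0 ?exprn_gt0.
suff : `|c m - c n| <= M / 2 ^+ n - M / 2 ^+ m.
  move=> /le_trans; apply; rewrite gerBl.
  by rewrite divr_ge0 ?exprn_ge0.
elim: m nm => [|m IHm]; first by rewrite leqn0 => /eqP->; rewrite !subrr normr0.
rewrite leq_eqVlt => /predU1P[<-|nm]; first by rewrite !subrr normr0.
rewrite -(subrK (c m) (c m.+1)) -addrA (le_trans (ler_normD _ _))//.
rewrite (le_trans (lerD (cM m nm) (IHm nm)))// exprS.
rewrite le_eqVlt; apply/orP; left; apply/eqP; field.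
by rewrite !expf_neq0.
Qed.

Lemma halving_small (R : realType) (M e : R) : 0 < e ->
  \forall n \near \oo, M / 2 ^+ n < e.
Proof.
move=> e0.
have h : `|(2^-1 : R)| < 1 by rewrite ger0_norm// invf_lt1// ltr1n.
have /cvgrPdist_lt/(_ _ e0) := cvg_geometric M h.
apply: filterS => n; rewrite sub0r normrN /geometric/= exprVn.
exact/le_lt_trans/ler_norm.
Qed.

Lemma cvg_halving (R : realType) (E : completeNormedModType R) (c : nat -> E)
    (M : R) :
  (forall k, `|c k.+1 - c k| <= M / 2 ^+ k.+1) -> cvgn c.
Proof.
move=> cM; apply: cauchy_cvg; apply/cauchyP => e e0.
have [n _ Mn] := halving_small M e0.
exists (c n); exists n => // m nm; rewrite -ball_normE/= distrC.
apply: le_lt_trans (Mn n (leqnn n)).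
exact: ler_dist_halving.
Qed.

Lemma approx_minimizer (R : realType) (E : normedModType R) (A : set E)
    (w : E) (d : R) :
  A !=set0 -> 0 < d ->
  exists z, A z /\ forall y, A y -> `|w + z| <= `|w + y| + d.
Proof.
move=> [y0 Ay0] d0; pose D := [set `|w + y| | y in A].
have lbD : has_lbound D by exists 0 => _ [y _ <-].
have infD : has_inf D by split=> //; exists `|w + y0|; exists y0.
have [_ [z Az <-] zd] := inf_adherent d0 infD.
exists z; split => // y Ay; apply: (le_trans (ltW zd)).
by rewrite lerD2r ge_inf//; exists y.
Qed.

(** Midpoints suffice for what follows, and make it easy to exhibit countable
    examples. *)
Definition midpoint_convex (R : realType) (E : lmodType R) (A : set E) : Prop :=
  forall x y, A x -> A y -> A (2^-1 *: (x + y)).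

(** A quantitative form of Simons' inequality. Pick z_n in C_n so that
    w_n + z_n nearly minimizes the norm over w_n + C_n, where w_0 = 0 and
    w_(n+1) = 2 w_n + z_n. Then w_n / 2^n converges to v = \sum_n z_n / 2^(n+1).
    Comparing z_n with the competitor (z_n + z_(n+1)) / 2 makes
    |w_n + z_n| / 2^n almost nondecreasing in n, with limit |v|; hence
    |z_0| <= |v| up to a small error, and each increment w_(n+1) - w_n = w_n + z_n
    has norm at most 2^n |v| up to a small error. If phi_i attains the norm of
    v, summing the increments gives |phi_i (w_n)| <= (2^n - 1) |v| up to a
    constant error. As phi_i (2^n v) = 2^n |v| in absolute value, the remaining
    |v| comes from phi_i (2^n v - w_n), an average of the values phi_i (z_k) with
    k >= n, which are small. So |v|, and with it |z_0|, is small. *)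
Lemma simons_small_element (R : realType) (E : completeNormedModType R) (I : Type)
    (phi : I -> E -> R) (C : nat -> set E) (M e : R) :
  (forall i, scalar (phi i)) ->
  (forall i y, `|phi i y| <= `|y|) ->
  (forall y, y != 0 -> exists i, `|phi i y| = `|y|) ->
  (forall n, C n !=set0) ->
  (forall n, C n.+1 `<=` C n) ->
  (forall n, midpoint_convex (C n)) ->
  (forall y, C 0%N y -> `|y| <= M) ->
  (forall i d, 0 < d -> exists n, forall y, C n y -> `|phi i y| <= d) ->
  0 < e -> exists2 y, C 0%N y & `|y| < e.
Proof.
move=> phil phin phia C0 CS Cmid CM Cphi e0.
have phiB i x y : phi i (x - y) = phi i x - phi i y.
  by rewrite -(scaleN1r y) addrC phil mulN1r addrC.
have phiZ i a x : phi i (a *: x) = a * phi i x.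
  have phi0 : phi i 0 = 0 by rewrite -(subrr 0) phiB subrr.
  by rewrite -[a *: x]addr0 phil phi0 addr0.
have phiD i x y : phi i (x + y) = phi i x + phi i y.
  by rewrite -[x]scale1r phil mul1r scale1r.
have Cle m n : (m <= n)%N -> C n `<=` C m.
  elim: n => [|n IHn]; first by rewrite leqn0 => /eqP->.
  rewrite leq_eqVlt => /predU1P[->//|/IHn]; apply: subset_trans.
  exact: CS.
pose d : R := e / 8.
have d0 : 0 < d by rewrite divr_gt0.
have step (p : nat * E) : exists z, C p.1 z /\ forall y, C p.1 y ->
    `|p.2 + z| <= `|p.2 + y| + d / 2 ^+ p.1.
  by apply: approx_minimizer => //; rewrite divr_gt0 ?exprn_gt0.
have [z zP] := choice step.
pose w n := iteri n (fun k x => 2 *: x + z (k, x)) 0.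
pose s n := z (n, w n).
have wS n : w n.+1 = 2 *: w n + s n by [].
have Cs n : C n (s n) by case: (zP (n, w n)).
have smin n y : C n y -> `|w n + s n| <= `|w n + y| + d / 2 ^+ n.
  by case: (zP (n, w n)) => _; apply.
have q0 n : (2 ^+ n : R) != 0 by rewrite expf_neq0.
pose c n := (2 ^+ n)^-1 *: w n.
have cS n : c n.+1 - c n = (2 ^+ n.+1)^-1 *: s n.
  rewrite /c wS scalerDr scalerA addrAC -scalerBl exprS.
  rewrite (_ : _ - _ = 0) ?scale0r ?add0r//.
  by move: (q0 n); move: (2 ^+ n : R) => q qN0; field.
have cM k : `|c k.+1 - c k| <= M / 2 ^+ k.+1.
  rewrite cS normrZ gtr0_norm ?invr_gt0 ?exprn_gt0// mulrC.
  rewrite ler_pM2r ?invr_gt0 ?exprn_gt0//.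
  by apply: CM; apply: Cle (Cs k).
have /cvg_ex[v cv] := cvg_halving cM.
pose a n := w n + s n.
have wE n : w n = 2 ^+ n *: c n by rewrite /c scalerA mulfV// scale1r.
have aE n : a n = 2 ^+ n *: (2 *: c n.+1 - c n).
  rewrite scalerBr scalerA -exprSr -!wE wS scaler_nat mulr2n.
  by rewrite addrAC addrK.
have aS n : `|a n| <= 2^-1 * `|a n.+1| + d / 2 ^+ n.
  have := smin n (2^-1 *: (s n + s n.+1))
    (Cmid _ _ _ (Cs n) (CS _ _ (Cs n.+1))).
  congr (_ <= _ + _).
  rewrite -[2^-1]ger0_norm// -normrZ ger0_norm//; congr `|_|.
  rewrite /a wS -addrA !scalerDr scalerA mulVf// scale1r//.
(* The subtracted term telescopes: it absorbs the error d / 4^n made at each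
   step, so that b is truly nondecreasing. *)
pose b n := `|a n| / 2 ^+ n - 2 * d / (2 ^+ n) ^+ 2.
have bS n : b n <= b n.+1.
  rewrite /b (exprS _ n); have := aS n.
  have : (0 < 2 ^+ n :> R) by rewrite exprn_gt0.
  move: (2 ^+ n : R) => q qgt0 h.
  rewrite -subr_ge0.
  have -> : `|a n.+1| / (2 * q) - 2 * d / (2 * q) ^+ 2
      - (`|a n| / q - 2 * d / q ^+ 2)
      = (2^-1 * `|a n.+1| + d / q - `|a n|) / q + 2^-1 * d / q ^+ 2.
    by field; rewrite gt_eqF.
  apply: addr_ge0; first by rewrite divr_ge0 ?subr_ge0 ?(ltW qgt0).
  by rewrite divr_ge0 ?exprn_ge0 ?(ltW qgt0)// mulr_ge0 ?(ltW d0).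
have bv : b n @[n --> \oo] --> `|v|.
  have -> : b = (fun n =>
      `|2 *: c n.+1 - c n| - geometric (2 * d) (2^-1 ^+ 2) n).
    apply/funext => n; rewrite /b aE normrZ gtr0_norm ?exprn_gt0//.
    by rewrite mulrAC mulfV// mul1r /geometric/= -exprM mulnC exprM -!exprVn.
  rewrite -[X in _ --> X]subr0; apply: cvgB; last first.
    by apply: cvg_geometric; rewrite ger0_norm// expr2; lra.
  have c1 : c n.+1 @[n --> \oo] --> v by rewrite (cvg_shiftS c).
  have h : 2 *: c n.+1 - c n @[n --> \oo] --> 2 *: v - v.
    by apply: cvgB => //; exact: cvgZl_tmp.
  by rewrite [2 *: v]scaler_nat mulr2n addrK in h; exact: (cvg_norm h).
have alev n : `|a n| <= 2 ^+ n * `|v| + 2 * d / 2 ^+ n.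
  have : b n <= `|v|.
    rewrite -(cvg_lim (@Rhausdorff R) bv).
    apply: (nondecreasing_cvgn_le (u_ := b)).
      exact/nondecreasing_seqP.
    by apply/cvg_ex; exists `|v|.
  rewrite /b; have : (0 < 2 ^+ n :> R) by rewrite exprn_gt0.
  move: (2 ^+ n : R) => q qgt0.
  rewrite lerBlDr ler_pdivrMr// => /le_trans; apply.
  rewrite le_eqVlt; apply/orP; left; apply/eqP; field.
  by rewrite gt_eqF.
exists (s 0%N) => //.
have s0v : `|s 0%N| <= `|v| + 2 * d.
  by have := alev 0%N; rewrite /a /w/= add0r expr0 mul1r divr1.
suff : `|v| <= 5 * d by rewrite /d in s0v *; lra.
have [->|/phia[i iv]] := eqVneq v 0; first by rewrite normr0 mulr_ge0 ?ltW.
have [n Cn] := Cphi i d d0.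
have wle m : `|phi i (w m)| <= (2 ^+ m - 1) * `|v| + 4 * d * (1 - (2 ^+ m)^-1).
  elim: m => [|m IHm].
    rewrite expr0 subrr mul0r invr1 subrr mulr0 addr0 /w/=.
    by rewrite -(scale0r 0) phiZ mul0r normr0.
  have -> : w m.+1 = w m + a m by rewrite wS /a scaler_nat mulr2n addrA.
  rewrite phiD (le_trans (ler_normD _ _))//.
  rewrite (le_trans (lerD IHm (le_trans (phin _ _) (alev m))))//.
  rewrite exprS; move: (q0 m); move: (2 ^+ m : R) => q qN0.
  by rewrite le_eqVlt; apply/orP; left; apply/eqP; field.
have phiv : `|phi i v - phi i (c n)| <= d / 2 ^+ n.
  apply/ler_addgt0Pr => r r0.
  have /cvgrPdist_le/(_ r r0)[N _ vN] := cv.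
  have nm : (n <= maxn n N)%N by rewrite leq_maxl.
  rewrite -(subrK (phi i (c (maxn n N))) (phi i v)) -addrA addrC.
  rewrite (le_trans (ler_normD _ _))// lerD//.
    apply: (@ler_dist_halving R R (phi i \o c)) nm => k nk /=.
    rewrite -phiB cS phiZ normrM gtr0_norm ?invr_gt0 ?exprn_gt0// mulrC.
    rewrite ler_pM2r ?invr_gt0 ?exprn_gt0//.
    by apply: Cn; apply: Cle nk _ (Cs k).
  by rewrite -phiB (le_trans (phin _ _))// vN//= leq_maxr.
have q1 : 0 < 2 ^+ n :> R by rewrite exprn_gt0.
have phiw : phi i (c n) = phi i (w n) / 2 ^+ n by rewrite phiZ mulrC.
have vq : `|v| * 2 ^+ n <= `|phi i (w n)| + d.
  rewrite -iv -ler_pdivlMr// mulrDl -lerBlDl (le_trans _ phiv)//.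
  rewrite phiw -[X in _ - _ / X]gtr0_norm// -normf_div.
  exact: lerB_dist.
have := le_trans vq (lerD (wle n) (lexx d)).
have : 0 <= d * (2 ^+ n)^-1 by rewrite mulr_ge0 ?invr_ge0 ?ltW.
lra.
Qed.

(** * The weighted norm is attained *)

Lemma wbfun_dist_le (R : realType) (X : topologicalType) (psi : weight R X)
    (f g : wbfun psi) (e : R) :
  `|f - g| <= e -> forall x, `|f x - g x| <= e * psi x.
Proof.
move=> fg x; apply: le_trans (ler_wnorm (f - g) x) _.
by rewrite ler_pM2r ?weight_gt0.
Qed.

Lemma wcfun_dist_le (R : realType) (X : topologicalType) (psi : weight R X)
    (f g : wcfun psi) (e : R) :
  `|f - g| <= e -> forall x, `|f x - g x| <= e * psi x.
Proof. by move=> fg; apply: wbfun_dist_le. Qed.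

Lemma weight_lsc (R : realType) (X : topologicalType) (psi : weight R X) :
  hausdorff_space X -> forall (r : R) (p : X), 0 < r -> r < psi p ->
  \forall x \near p, r < psi x.
Proof.
move=> hX r p r0 rp.
have oK : open (~` [set x | psi x <= r]).
  by apply: closed_openC; apply: compact_closed => //; exact: weight_compact.
have := open_nbhs_nbhs (conj oK (_ : (~` [set x | psi x <= r]) p)).
move/(_ (elimN idP _)); rewrite leNgt rp => /(_ erefl).
by apply: filterS => x /= /negP; rewrite -ltNge.
Qed.

(** With N = |f|, the point is a cluster point p of the sets
    S_c = {x | c psi x <= |f x|}, as c increases to N. They are nonempty by
    definition of N. Approximating f within N/4 by a bounded g forces psi to be
    bounded on S_(N/2), so these sets end up in a compact sublevel set and p
    exists. At p, approximating f by a continuous g, together with lower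
    semicontinuity of psi, passes the inequality to the limit. *)
Lemma wcfun_norm_attained (R : realType) (X : topologicalType)
    (psi : weight R X) :
  hausdorff_space X -> forall f : wcfun psi, f != 0 ->
  exists x, `|f x| = `|f| * psi x.
Proof.
move=> hX f f0; pose N : R := `|f|.
have N0 : 0 < N by rewrite normr_gt0.
have fle x : `|f x| <= N * psi x := ler_wnorm (f : wbfun psi) x.
pose S (c : R) : set X := [set x | c * psi x <= `|f x|].
have S0 c : 0 < c < N -> S c !=set0.
  move=> /andP[c0 cN]; apply: contrapT => Sc.
  have : N <= c.
    apply: wnorm_le (ltW c0) _ => x; rewrite leNgt; apply/negP => /ltW xc.
    by apply: Sc; exists x.
  by rewrite leNgt cN.
pose F : set_system X := filter_from [set c : R | 0 < c < N] S.
have FF : ProperFilter F.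
  apply: filter_from_proper => //; apply: filter_from_filter.
    by exists (N / 2); rewrite /= divr_gt0//= ltr_pdivrMr// ltr_pMr// ltr1n.
  move=> a b /= /andP[a0 aN] /andP[b0 bN].
  exists (Num.max a b); first by rewrite /= lt_max a0 gt_max aN.
  move=> x; rewrite /S/= => abx; split; apply: le_trans abx;
   by rewrite ler_pM2r ?weight_gt0// le_max lexx ?orbT.
have [p clp] : exists p, cluster F p.
  have N4 : 0 < N / 4 by rewrite divr_gt0.
  have [g [_ /bounded_fun_exP[M gM]] fg] := (closure_CbP f).1 (wcfunP f) _ N4.
  have r0 : 0 < Num.max 1 (M / (N / 4)) by rewrite lt_max ltr01.
  have [|p [_ ?]] := @weight_compact _ _ psi _ r0 F FF; last by exists p.
  exists (N / 2); first by rewrite /= divr_gt0//= ltr_pdivrMr// ltr_pMr// ltr1n.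
  move=> x; rewrite /S/= => Sx; rewrite le_max ler_pdivlMr//; apply/orP; right.
  have fgx := wbfun_dist_le (ltW fg) x.
  have := ler_normD (f x - g x) (g x); rewrite subrK.
  have := gM x; move: fgx Sx; lra.
exists p; apply/eqP; rewrite eq_le fle/= -/N.
(* r stands below psi p for lower semicontinuity, and h is the accuracy with
   which a continuous function replaces f. *)
have key r h : 0 < r -> r < psi p -> 0 < h -> 2 * h < N ->
    (N - 2 * h) * r <= `|f p| + h * psi p.
  move=> r0 rp h0 hN.
  have [g [gc _] fg] := (closure_CbP f).1 (wcfunP f) _ h0.
  have fgx := wbfun_dist_le (ltW fg).
  have gp : (N - 2 * h) * r <= `|g p|.
    rewrite leNgt; apply/negP => gpr.
    have cg : `|g x| @[x --> p] --> `|g p| by apply: cvg_norm; exact: gc.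
    have nr : \forall x \near p, `|g x| < (N - 2 * h) * r.
      exact: cvgr_lt cg _ gpr.
    have nS : F (S (N - h)) by exists (N - h) => //=; apply/andP; split; lra.
    have [x [Sx [/= gx rx]]] := clp _ _ nS (filterI nr (weight_lsc hX r0 rp)).
    have := ler_normD (f x - g x) (g x); rewrite subrK.
    have := fgx x; rewrite /S/= in Sx.
    have : (N - 2 * h) * r <= (N - 2 * h) * psi x by rewrite ler_pM2l ?ltW//; lra.
    move: Sx gx; lra.
  have := ler_normD (g p - f p) (f p); rewrite subrK distrC.
  have := fgx p; move: gp; lra.
rewrite leNgt; apply/negP => fpN.
have pp := weight_gt0 psi p.
(* h and psi p - r are taken so small that together they use up less than the
   assumed gap D. *)
pose D := N * psi p - `|f p|.
have D0 : 0 < D by rewrite subr_gt0.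
pose h := Num.min (D / (8 * psi p)) (N / 4).
have h0 : 0 < h by rewrite lt_min !divr_gt0// mulr_gt0.
have hN : h <= N / 4 by rewrite ge_min lexx orbT.
have hD : h * psi p <= D / 8.
  have : h <= D / (8 * psi p) by rewrite ge_min lexx.
  by rewrite ler_pdivlMr ?mulr_gt0// mulrA mulrAC -ler_pdivlMr.
pose t := Num.min (D / (8 * N)) (psi p / 2).
have t0 : 0 < t by rewrite lt_min !divr_gt0// mulr_gt0.
have tp : t <= psi p / 2 by rewrite ge_min lexx orbT.
have tD : t * N <= D / 8.
  have : t <= D / (8 * N) by rewrite ge_min lexx.
  by rewrite ler_pdivlMr ?mulr_gt0// mulrA mulrAC -ler_pdivlMr.
have := @key (psi p - t) h; rewrite subr_gt0 ltrBlDr ltrDl.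
move=> /(_ ltac:(lra) t0 h0 ltac:(lra)).
have : 0 <= h * t by rewrite mulr_ge0 ?ltW.
move: hD tD D0; rewrite /D; lra.
Qed.

(** * A Baire theorem for sets closed under limits from the right *)

(** The half-open topology of the line is not metrizable, but the usual
    Baire theorem is enough. If A_i contains no interval, every interval has a
    point p outside A_i, and then a whole interval ]p, p + r[ outside A_i: so the
    interior of the complement of A_i is dense. The extra union with the
    complement of [c, d] in [U] makes these sets dense in the whole line. *)
Lemma right_closed_cover (R : realType) (T : countType) (A : T -> set R) (c d : R) :
  c < d ->
  (forall i p, c < p < d -> ~ A i p -> \forall t \near p^'+, ~ A i t) ->
  (forall p, c < p < d -> exists i, A i p) ->
  exists i a b, [/\ c <= a, a < b, b <= d & forall p, a < p < b -> A i p].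
Proof.
move=> cd Acl Acov; apply: contrapT => nA.
pose B n : set R := if unpickle n is Some i then A i else set0.
pose U n : set R := (~` B n)^° `|` ~` `[c, d].
have oU n : open (U n).
  by apply: openU; [exact: open_interior|apply: closed_openC; exact: itv_closed].
have dU n : dense (U n).
  move=> O [x Ox] oO; apply: contrapT => nOU.
  have Ocd y : O y -> ~ U n y by move=> Oy Uy; apply: nOU; exists y.
  have Oc y : O y -> c <= y <= d.
    move=> /Ocd nU; apply: contrapT => ny; apply: nU; right => /=.
    by rewrite in_itv.
  have [e /= e0 xe] : nbhs_ball x O by apply/nbhs_ballP; exact: open_nbhs_nbhs.
  have Oe y : x < y < x + e -> O y.
    move=> /andP[xy ye]; apply: xe.
    rewrite -ball_normE/= distrC gtr0_norm ?subr_gt0//.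
    by rewrite ltrBlDl.
  have xO : c <= x by have /andP[] := Oc _ Ox.
  have xed : x + e <= d.
    rewrite leNgt; apply/negP => dx.
    have /Oc/andP[_] : O ((Num.max x d + (x + e)) / 2).
      apply: Oe; have : x <= Num.max x d by rewrite le_max lexx.
      have : Num.max x d < x + e by rewrite gt_max dx ltrDl e0.
      by move=> ? ?; apply/andP; split; lra.
    have : d <= Num.max x d by rewrite le_max lexx orbT.
    lra.
  have [p [pi nBp]] : exists p, x < p < x + e /\ ~ B n p.
    apply: contrapT => nB.
    have Bp p : x < p < x + e -> B n p.
      by move=> pi; apply: contrapT => nBp; apply: nB; exists p.
    rewrite /B in Bp; case: unpickle Bp => [i|] Bp; last first.
      by apply: (Bp (x + e / 2)); apply/andP; split; lra.
    by apply: nA; exists i, x, (x + e); split; rewrite ?ltrDl.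
  have /andP[xp pe] := pi.
  have nearB : \forall t \near p^'+, ~ B n t.
    move: nBp; rewrite /B; case: unpickle => [i|_]; last first.
      by apply: nearW => t [].
    by apply: Acl; apply/andP; split; lra.
  have pe' : 0 < x + e - p by lra.
  have [r /= r0 pr] := nearB.
  pose m := Num.min r (x + e - p).
  have m0 : 0 < m by rewrite lt_min r0.
  have mr : m <= r by rewrite ge_min lexx.
  have me : m <= x + e - p by rewrite ge_min lexx orbT.
  apply: (@Ocd (p + m / 2)); first by apply: Oe; apply/andP; split; lra.
  left; rewrite /interior.
  apply: filterS (near_in_itvoo (_ : p + m / 2 \in `]p, p + m[)).
    move=> y; rewrite /= in_itv/= => /andP[py ym]; apply: pr => //=.
    by rewrite distrC gtr0_norm; lra.
  by rewrite in_itv/=; apply/andP; split; lra.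
have [|x [/= xcd xU]] := @Baire R R^o U (fun n => conj (oU n) (dU n))
    [set` `]c, d[] _ (@itv_open _ R _ _).
  by exists ((c + d) / 2); rewrite /= in_itv/= ; apply/andP; split; lra.
rewrite in_itv/= in xcd; have [i Ax] := Acov _ xcd.
have [/interior_subset|] := xU (pickle i) I.
  by rewrite /B /= pickleK; apply.
by apply; rewrite /= in_itv/=; case/andP : xcd => /ltW -> /ltW ->.
Qed.

(** * From pointwise to norm approximation *)

Lemma sub_midpoint (R : realType) (E : lmodType R) (f y z : E) :
  f - 2^-1 *: (y + z) = 2^-1 *: ((f - y) + (f - z)).
Proof.
rewrite addrACA -opprD scalerBr [_ *: (f + f)]scalerDr -scalerDl.
have -> : 2^-1 + 2^-1 = 1 :> R by lra.
by rewrite scale1r.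
Qed.

(** Mazur's theorem for bounded pointwise convergence. The sets C_n collect the
    differences f - h, with h in V, that are bounded and at every point no
    larger than the tail (f - u_k), k >= n: they contain f - u_n, are stable under
    midpoints, and shrink to 0 at every point. *)
Lemma closure_pointwise_limit (R : realType) (X : topologicalType)
    (psi : weight R X) (V : set (wcfun psi)) (u : nat -> wcfun psi)
    (f : wcfun psi) (M : R) :
  hausdorff_space X -> midpoint_convex V -> (forall n, V (u n)) ->
  (forall n, `|u n| <= M) -> (forall x, u n x @[n --> \oo] --> f x) ->
  closure V f.
Proof.
move=> hX Vmid Vu uM uf.
pose phi x (g : wcfun psi) : R := g x / psi x.
pose C n : set (wcfun psi) := [set y | [/\ V (f - y), `|y| <= `|f| + M &
  forall x r, (forall k, (n <= k)%N -> `|f x - u k x| <= r) -> `|y x| <= r]].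
suff small e : 0 < e -> exists2 y, C 0%N y & `|y| < e.
  move=> B /nbhs_ballP[e /= e0 eB]; have [y [Vy _ _] ye] := small e e0.
  exists (f - y); split => //; apply: eB.
  by rewrite -ball_normE/= opprB addrC subrK.
apply: (@simons_small_element R (wcfun psi) X phi C (`|f| + M) e).
- move=> x a g h; rewrite /phi [X in X / _](_ : _ = a * g x + h x)//.
  by rewrite mulrDl mulrA.
- move=> x y; rewrite /phi normrM normfV (gtr0_norm (weight_gt0 _ _)).
  by rewrite ler_pdivrMr ?weight_gt0//; exact: (ler_wnorm (y : wbfun psi) x).
- move=> y /(wcfun_norm_attained hX)[x xy]; exists x.
  rewrite /phi normrM normfV (gtr0_norm (weight_gt0 _ _)) xy mulfK//.
  by rewrite gt_eqF// weight_gt0.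
- move=> n; exists (f - u n); split.
  + by rewrite opprB addrC subrK.
  + by rewrite (le_trans (ler_normB _ _))// lerD2l.
  + by move=> x r; apply.
- move=> n y [Vy yM yr]; split => // x r nr; apply: yr => k nk.
  by apply: nr; exact: ltnW.
- move=> n y z [Vy yM yr] [Vz zM zr].
  have half (a b m : R) : `|a| <= m -> `|b| <= m -> `|2^-1 * (a + b)| <= m.
    by rewrite !ler_norml => /andP[? ?] /andP[? ?]; apply/andP; split; lra.
  split.
  + rewrite (_ : f - _ = 2^-1 *: ((f - y) + (f - z))); first exact: Vmid.
    exact: sub_midpoint.
  + rewrite normrZ ger0_norm// -ler_pdivlMl ?invr_gt0// invrK.
    by rewrite (le_trans (ler_normD _ _))// mulr_natl mulr2n lerD.
  + move=> x r nr; rewrite [X in `|X|](_ : _ = 2^-1 * (y x + z x))//.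
    by apply: half; [exact: yr|exact: zr].
- by move=> y [].
- move=> x d d0.
  have dx0 : 0 < d * psi x by rewrite mulr_gt0// weight_gt0.
  have /cvgrPdist_le/(_ _ dx0)[n _ un] := uf x.
  exists n => y [_ _ yr].
  rewrite /phi normrM normfV (gtr0_norm (weight_gt0 _ _)).
  by rewrite ler_pdivrMr ?weight_gt0//; exact: yr.
Qed.

Lemma closure_right_limit (R : realType) (X : topologicalType)
    (psi : weight R X) (V : set (wcfun psi)) (u : R -> wcfun psi) (p M : R) :
  hausdorff_space X -> midpoint_convex V ->
  (forall x, u t x @[t --> p^'+] --> u p x) ->
  (forall r, p < r -> exists t, [/\ p < t < r, V (u t) & `|u t| <= M]) ->
  closure V (u p).
Proof.
move=> hX Vmid up dense_V.
have pn (n : nat) : p < p + n.+1%:R^-1 by rewrite ltrDl invr_gt0.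
have [t tP] := choice (fun n => dense_V _ (pn n)).
have tp : t n @[n --> \oo] --> p.
  have p0 : p + n.+1%:R^-1 @[n --> \oo] --> p.
    by rewrite -[X in _ --> X]addr0; apply: cvgD; [exact: cvg_cst|exact: cvg_harmonic].
  apply: (squeeze_cvgr _ (cvg_cst p) p0); apply: nearW => n.
  by have [/andP[/ltW-> /ltW->]] := tP n.
apply: (closure_pointwise_limit (u := u \o t) (M := M)) => //.
- by move=> n; case: (tP n).
- by move=> n; case: (tP n).
- move=> x; have /cvg_at_rightP := up x; apply; split => // n.
  by have [/andP[]] := tP n.
Qed.

(** * Separability of orbits and small oscillation *)

(** Indexed by a countable type, for use with the Baire argument. *)
Definition rat_comb (R : realType) (E : lmodType R) (u : R -> E)
    (s : seq (rat * rat)) : E :=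
  \sum_(c <- s) ratr c.1 *: u (ratr c.2).

Lemma midpoint_convex_rat_comb (R : realType) (E : lmodType R) (u : R -> E) :
  midpoint_convex (range (rat_comb u)).
Proof.
move=> _ _ [s _ <-] [s' _ <-].
exists [seq (c.1 / 2, c.2) | c <- s ++ s'] => //.
rewrite /rat_comb big_map -big_cat scaler_sumr; apply: eq_bigr => c _ /=.
by rewrite scalerA rmorphM/= fmorphV/= rmorph_nat mulrC.
Qed.

(** Right continuity is only pointwise, yet the sets {p | |u p - s| <= e / 2} are
    closed under limits from the right, because the norm is a supremum of
    evaluations; they cover ]c, d[ when s ranges over the rational combinations
    of the values of u, because these approach every u p. *)
Lemma small_oscillation (R : realType) (X : topologicalType)
    (psi : weight R X) (u : R -> wcfun psi) (c d M e : R) :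
  hausdorff_space X -> c < d ->
  (forall p x, c < p < d -> u t x @[t --> p^'+] --> u p x) ->
  (forall p, c < p < d -> `|u p| <= M) -> 0 < e ->
  exists a b, [/\ c <= a, a < b, b <= d &
    forall p q, a < p < b -> a < q < b -> `|u p - u q| <= e].
Proof.
move=> hX cd urc uM e0.
have e20 : 0 < e / 2 by rewrite divr_gt0.
pose A s : set R := [set p | `|u p - rat_comb u s| <= e / 2].
have Acl s p : c < p < d -> ~ A s p -> \forall t \near p^'+, ~ A s t.
  move=> pcd nA.
  have [x ex] : exists x, e / 2 * psi x < `|u p x - rat_comb u s x|.
    apply: contrapT => nx; apply: nA.
    apply: (@wnorm_le _ _ psi (u p - rat_comb u s)) (ltW e20) _ => x.
    by rewrite leNgt; apply/negP => ?; apply: nx; exists x.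
  have : `|u t x - rat_comb u s x| @[t --> p^'+] --> `|u p x - rat_comb u s x|.
    by apply: cvg_norm; apply: cvgB; [exact: urc|exact: cvg_cst].
  move/cvgr_gt => /(_ _ ex); apply: filterS => t tx At.
  have := lt_le_trans tx (wcfun_dist_le At x).
  by rewrite ltxx.
have Acov p : c < p < d -> exists s, A s p.
  move=> /andP[cp pd].
  have : closure (range (rat_comb u)) (u p).
    apply: (closure_right_limit (M := M)) => //.
    - exact: midpoint_convex_rat_comb.
    - by move=> x; apply: urc; rewrite cp.
    move=> r pr; have : p < Num.min r d by rewrite lt_min pr.
    move=> /rat_in_itvoo[q]; rewrite in_itv/= lt_min => /and3P[pq qr qd].
    exists (ratr q); split; first by rewrite pq.
    + exists [:: (1, q)] => //.
      by rewrite /rat_comb big_seq1 rmorph1 scale1r.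
    + by apply: uM; rewrite (lt_trans cp pq).
  move=> /(_ _ (nbhsx_ballx _ _ e20))[_ [[s _ <-]]].
  by rewrite -ball_normE/= => /ltW us; exists s.
have [s [a [b [ca ab bd Aab]]]] := right_closed_cover cd Acl Acov.
exists a, b; split => // p q /Aab Ap /Aab Aq.
rewrite -(subrK (rat_comb u s) (u p)) -addrA (le_trans (ler_normD _ _))//.
rewrite [leRHS]splitr; apply: lerD; first exact: Ap.
by rewrite distrC; exact: Aq.
Qed.

(** * Strong continuity of the semigroup *)

Lemma opnorm_le (R : realType) (E F : normedModType R) (T : E -> F) (f : E) :
  bounded_linear T -> `|T f| <= opnorm T * `|f|.
Proof.
move=> [linT bT].
have T0 : T 0 = 0.
  by have := linT (-1) 0 0; rewrite scaler0 addr0 scaleN1r addNr.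
have TZ a g : T (a *: g) = a *: T g.
  by rewrite -[a *: g]addr0 linT T0 addr0.
have [->|f0] := eqVneq f 0; first by rewrite T0 !normr0 mulr0.
have f0' : 0 < `|f| by rewrite normr_gt0.
rewrite -ler_pdivrMr// mulrC -[X in X * _]gtr0_norm ?invr_gt0// -normrZ -TZ.
apply: ub_le_sup.
  by have [M TM] := bT 1; exists M => _ [g /= g1 <-]; exact: TM.
exists (`|f|^-1 *: f) => //=.
by rewrite normrZ gtr0_norm ?invr_gt0// mulVf ?gt_eqF.
Qed.

Theorem theorem3p2 (R : realType) (X : topologicalType)
    (hausdorffX : hausdorff_space X)
    (completely_regularX : completely_regular_space X)
    (psi : weight R X) (P : R -> wcfun psi -> wcfun psi)
    (P_bounded_linear : forall t : R, 0 <= t -> bounded_linear (P t))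
    (P_0 : forall f : wcfun psi, P 0 f = f)
    (P_semigroup : forall s t : R, 0 <= s -> 0 <= t ->
      forall f : wcfun psi, P (t + s) f = P t (P s f))
    (P_pointwise : forall (f : wcfun psi) (x : X),
      P t f x @[t --> (0 : R)^'+] --> f x)
    (P_locally_bounded : exists C : R, exists2 eps : R, 0 < eps &
      forall t : R, 0 <= t <= eps -> opnorm (P t) <= C) :
  forall f : wcfun psi, `|P t f - f| @[t --> (0 : R)^'+] --> (0 : R).
Proof.
move=> f.
have PB t g h : 0 <= t -> P t (g - h) = P t g - P t h.
  move=> /P_bounded_linear[/(_ (-1) h g) lin _].
  by rewrite addrC -scaleN1r lin scaleN1r addrC.
have [C [eps eps0 PC]] := P_locally_bounded.
pose K := `|C|.
have PK t g : 0 <= t <= eps -> `|P t g| <= K * `|g|.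
  move=> t0e; have /andP[t0 _] := t0e.
  rewrite (le_trans (opnorm_le g (P_bounded_linear t t0)))// ler_wpM2r//.
  by rewrite (le_trans (PC t t0e))// ler_norm.
have K0 : 0 <= K by exact: normr_ge0.
have K1 : 0 < K + 1 by rewrite ltr_wpDl.
have P_right g p x : 0 <= p -> P t g x @[t --> p^'+] --> P p g x.
  move=> p0; apply/(cvg_at_rightP (fun t => P t g x)) => s [ps sp].
  have /cvg_at_rightP := P_pointwise (P p g) x.
  move=> /(_ (fun n => s n - p)) h.
  rewrite (_ : (fun n => _) = (fun n => P (s n - p) (P p g) x)).
    apply: h; split; first by move=> n; rewrite subr_gt0.
    by rewrite -(subrr p); apply: cvgB => //; exact: cvg_cst.
  by apply/funext => n; rewrite -P_semigroup ?subr_ge0 ?(ltW (ps n))// subrK.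
pose V : set (wcfun psi) :=
  [set g | `|P t g - g| @[t --> (0 : R)^'+] --> (0 : R)].
have VP e g : V g -> 0 < e -> \forall t \near (0 : R)^'+, `|P t g - g| <= e.
  move=> /cvgr0Pnorm_le Vg e0.
  by have := Vg _ e0; apply: filterS => t; rewrite normr_id.
have PV g :
    (forall e, 0 < e -> \forall t \near (0 : R)^'+, `|P t g - g| <= e) -> V g.
  move=> h; apply/cvgr0Pnorm_le => e /h.
  by apply: filterS => t; rewrite normr_id.
have V_pos t : 0 < t <= eps -> V (P t f).
  move=> /andP[t0 te]; apply: PV => e e0.
  have r0 : 0 < e / (K + 1) by rewrite divr_gt0.
  have [||a [b [a0 ab bt osc]]] := @small_oscillation R X psi (P^~ f) 0 t
      (K * `|f|) (e / (K + 1)) hausdorffX t0 _ _ r0.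
  - by move=> p x /andP[/ltW p0 _]; exact: P_right.
  - by move=> p /andP[p0 pt]; apply: PK; lra.
  pose m := (a + b) / 2.
  near=> h.
  have h0 : 0 < h by near: h; exact: nbhs_right_gt.
  have hb : h < b - m by near: h; apply: nbhs_right_lt; rewrite /m; lra.
  rewrite -P_semigroup ?(ltW t0) ?(ltW h0)//.
  (* The orbit near t is the image under P_(t - m) of the orbit near m. *)
  rewrite (_ : P (h + t) f - P t f = P (t - m) (P (m + h) f - P m f));
    last first.
    rewrite PB; last by rewrite /m; lra.
    rewrite -!P_semigroup; [|rewrite /m in hb *; lra ..].
    by congr (P _ f - P _ f); lra.
  have tm : 0 <= t - m <= eps by rewrite /m; lra.
  rewrite (le_trans (PK _ _ tm))//.
  have mh : `|P (m + h) f - P m f| <= e / (K + 1).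
    by apply: osc; rewrite /m in hb *; lra.
  rewrite (le_trans (ler_wpM2l (normr_ge0 C) mh))// -/K.
  by rewrite mulrCA ler_piMr ?(ltW e0)// ler_pdivrMr// mul1r lerDl.
have V_mid : midpoint_convex V.
  move=> g h Vg Vh; apply: PV => e e0; near=> t.
  have t0 : 0 < t by near: t; exact: nbhs_right_gt.
  have lin := (P_bounded_linear t (ltW t0)).1.
  have -> : P t (2^-1 *: (g + h)) - 2^-1 *: (g + h)
      = 2^-1 *: ((P t g - g) + (P t h - h)).
    have PZ a k : P t (a *: k) = a *: P t k.
      have P0 : P t 0 = 0 by rewrite -(subrr (0 : wcfun psi)) PB ?subrr// ltW.
      by rewrite -[a *: k]addr0 lin P0 addr0.
    rewrite PZ -scalerBr -[g in P t (g + h)]scale1r lin scale1r.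
    by rewrite opprD addrACA.
  rewrite normrZ ger0_norm// -ler_pdivlMl ?invr_gt0// invrK.
  rewrite (le_trans (ler_normD _ _))// mulr_natl mulr2n lerD//.
    by near: t; exact: VP.
  by near: t; exact: VP.
have clV : closure V f.
  rewrite -[f]P_0.
  apply: (@closure_right_limit R X psi V (P^~ f) 0 (K * `|f|)) => //.
    by move=> x; exact: P_right.
  move=> r r0; have : 0 < Num.min r eps by rewrite lt_min r0.
  have mr : Num.min r eps <= r by rewrite ge_min lexx.
  have me : Num.min r eps <= eps by rewrite ge_min lexx orbT.
  move=> m0; exists (Num.min r eps / 2); split; first by lra.
    by apply: V_pos; lra.
  by apply: PK; lra.
apply: PV => e e0.
pose r := e / 2 / (K + 1).
have r0 : 0 < r by rewrite !divr_gt0.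
have [g [Vg]] := clV _ (nbhsx_ballx f r r0).
rewrite -ball_normE/= => /ltW fg.
near=> t.
have t0 : 0 < t by near: t; exact: nbhs_right_gt.
have te : t <= eps by near: t; exact: nbhs_right_ltW.
have Ptg : `|P t g - g| <= e / 2 by near: t; apply: VP; rewrite ?divr_gt0.
have Ptfg : `|P t (f - g)| <= K * r.
  by rewrite (le_trans (PK _ _ _)) ?ler_wpM2l// ?(ltW t0).
have -> : P t f - f = (P t (f - g) - (f - g)) + (P t g - g).
  by rewrite PB ?(ltW t0)// addrACA subrK -opprD subrK.
rewrite (le_trans (ler_normD _ _))// [leRHS]splitr lerD//.
rewrite (le_trans (ler_normB _ _))// (le_trans (lerD Ptfg fg))//.
by rewrite -[X in _ + X]mul1r -mulrDl mulrC divfK ?gt_eqF.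
Unshelve. all: by end_near. Qed.
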